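(* Let $p$ be a prime number. Up to isomorphism, there exist exactly $2$ commutative non-degenerate solutions on a left-zero semigroup of size $p$: (1) the solution $(\mathbb{Z}/p\mathbb{Z},s)$ given by $s(x,y)=(x,-x+y)$ for all $x,y\in\mathbb{Z}/p\mathbb{Z}$; (2) the solution $(\mathbb{Z}/p\mathbb{Z},s)$ given by $s(x,y)=(x,y)$ for all $x,y\in\mathbb{Z}/p\mathbb{Z}$.
   Context: A solution (set-theoretic solution of the Pentagon Equation) is a pair $(S,s)$ with $S$ a non-empty set and $s:S\times S\to S\times S$ a map such that $s_{23}s_{13}s_{12}=s_{12}s_{23}$ as maps $S^3\to S^3$, where $s_{12}=s\times \mathrm{id}$, $s_{23}=\mathrm{id}\times s$, $s_{13}=(\tau\times \mathrm{id})(\mathrm{id}\times s)(\tau\times \mathrm{id})$ and $\tau(x,y)=(y,x)$. Writing $s(x,y)=(x\cdot y,\theta_x(y))$, the pair $(S,s)$ is a solution if and only if for all $x,y,z\in S$: $(x\cdot y)\cdot z=x\cdot(y\cdot z)$, $\theta_x(y)\cdot\theta_{x\cdot y}(z)=\theta_x(y\cdot z)$, and $\theta_{\theta_x(y)}\theta_{x\cdot y}=\theta_y$; one says $(S,s)$ is a solution on the semigroup $(S,\cdot)$. It is commutative if $s_{12}s_{13}=s_{13}s_{12}$, equivalently $x\cdot y\cdot z=x\cdot z\cdot y$ and $\theta_{x\cdot y}=\theta_x$ for all $x,y,z\in S$. It is non-degenerate if every $\theta_x:S\to S$ is bijective. A semigroup is left-zero if $x\cdot y=x$ for all $x,y$.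 Two solutions $(S,s)$, $(T,t)$ are isomorphic if there is a bijection $\phi:S\to T$ with $(\phi\times\phi)s=t(\phi\times\phi)$. *)

(* Defs.v *)
From mathcomp Require Import all_boot all_order all_algebra.

Set Implicit Arguments.
Unset Strict Implicit.
Unset Printing Implicit Defensive.

Import GRing.Theory.
Local Open Scope ring_scope.

Section PentagonMaps.

Variable S : Type.
Implicit Type s : S * S -> S * S.

(* S^3 is represented as (S * S) * S, so (x, y, z) is ((x, y), z). *)

Definition leg12 s (t : S * S * S) : S * S * S := (s t.1, t.2).

Definition leg23 s (t : S * S * S) : S * S * S :=
  let: (x, y, z) := t in let: (y', z') := s (y, z) in (x, y', z').

Definition flip (u : S * S) : S * S := (u.2, u.1).

Definition leg13 s : S * S * S -> S * S * S :=
  leg12 flip \o leg23 s \o leg12 flip.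

Definition pentagon_solution s : Prop :=
  inhabited S /\ leg23 s \o leg13 s \o leg12 s =1 leg12 s \o leg23 s.

Definition commutative_solution s : Prop :=
  leg12 s \o leg13 s =1 leg13 s \o leg12 s.

(* s (x, y) = (pmul s x y, theta s x y); associativity of pmul s is part of  *)
(* the pentagon equation.                                                    *)
Definition pmul s (x y : S) : S := (s (x, y)).1.

Definition theta s (x y : S) : S := (s (x, y)).2.

Definition nondegenerate s : Prop := forall x, bijective (theta s x).

Definition left_zero_mul (mul : S -> S -> S) : Prop :=
  forall x y, mul x y = x.

End PentagonMaps.

Definition isomorphic_solutions (S T : Type)
    (s : S * S -> S * S) (t : T * T -> T * T) : Prop :=
  exists phi : S -> T, bijective phi /\
    let phi2 u := (phi u.1, phi u.2) in phi2 \o s =1 t \o phi2.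

Definition comm_nondeg_left_zero_of_size
    (p : nat) (S : finType) (s : S * S -> S * S) : Prop :=
  [/\ #|S| = p, pentagon_solution s, commutative_solution s,
      nondegenerate s & left_zero_mul (pmul s)].

(* 'Z_p is the ring of integers modulo p only for p > 1. *)
Definition shift_solution (p : nat) (u : 'Z_p * 'Z_p) : 'Z_p * 'Z_p :=
  (u.1, - u.1 + u.2).

Definition trivial_solution (p : nat) (u : 'Z_p * 'Z_p) : 'Z_p * 'Z_p :=
  (u.1, u.2).

(* Main.v *)
Require Import Defs.
From mathcomp Require Import all_boot all_order all_algebra.
From mathcomp Require Import all_fingroup cyclic.

(** On a left-zero semigroup a solution is a family of maps [theta_x] subject
    to the single condition [theta_(theta_x y) o theta_x = theta_y], and it is
    automatically commutative.  If every [theta_x] is a permutation, the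
    condition reads [theta_(theta_x y) = theta_x^-1 * theta_y] in the group of
    permutations (products being read from left to right).  Hence the set [A]
    of all [theta_x] is closed under [a, b |-> a^-1 * b], so it is a group
    ([theta_group_set]), and [theta_x] carries the fibre of [theta] over
    [theta_x] onto the fibre over [1], so that all fibres have the same size
    ([theta_perm_fibre]) and [#|A|] divides [#|S|] ([card_theta_dvd]).

    When [#|S|] is a prime [p], two cases remain.  If [#|A| = 1], every
    [theta_x] is the identity and the solution is the trivial one.  If
    [#|A| = p], then [theta] is injective, so it transports the solution to
    [(a, b) |-> (a, a^-1 * b)] on [A]; as [A] is cyclic of order [p], this is
    [(x, y) |-> (x, - x + y)] on the integers modulo [p]. *)

Set Implicit Arguments.
Unset Strict Implicit.
Unset Printing Implicit Defensive.

Import GRing.Theory GroupScope.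
Local Open Scope group_scope.

Section LeftZero.

Variables (S : Type) (s : S * S -> S * S).
Hypothesis s_left_zero : left_zero_mul (pmul s).

Lemma left_zeroE x y : s (x, y) = (x, theta s x y).
Proof.
by have := s_left_zero x y; rewrite /pmul /theta; case: (s _) => a b /= ->.
Qed.

Lemma left_zero_commutative : commutative_solution s.
Proof.
by move=> [[x y] z]; rewrite /leg13 /leg12 /leg23 /=; do !rewrite left_zeroE /=.
Qed.

(** The first two coordinates of the two sides of the pentagon equation always
    agree on a left-zero semigroup; only the third one imposes a condition. *)
Lemma left_zero_pentagonP :
  leg23 s \o leg13 s \o leg12 s =1 leg12 s \o leg23 s <->
  forall x y z, theta s (theta s x y) (theta s x z) = theta s y z.
Proof.
have legsE x y z :
  ((leg23 s \o leg13 s \o leg12 s) (x, y, z)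
     = (x, theta s x y, theta s (theta s x y) (theta s x z)))
  * ((leg12 s \o leg23 s) (x, y, z) = (x, theta s x y, theta s y z)).
  by rewrite /leg13 /leg12 /leg23 /=; do !rewrite left_zeroE /=.
split=> [pent x y z | thetaM [[x y] z]]; last by rewrite !legsE thetaM.
by have := pent (x, y, z); rewrite !legsE => -[].
Qed.

End LeftZero.

Section ThetaGroup.

Variables (S : finType) (s : S * S -> S * S).
Hypothesis s_nondeg : Defs.nondegenerate s.
Hypothesis thetaM :
  forall x y z, theta s (theta s x y) (theta s x z) = theta s y z.

Definition theta_perm x : {perm S} := perm (bij_inj (s_nondeg x)).

Lemma theta_permE x y : theta_perm x y = theta s x y.
Proof. by rewrite permE. Qed.

(** This form of the pentagon condition makes [theta_perm] a morphism from [s]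
    to the solution [(a, b) |-> (a, a^-1 * b)] on permutations. *)
Lemma theta_permM x y :
  theta_perm (theta_perm x y) = (theta_perm x)^-1 * theta_perm y.
Proof.
apply: (mulgI (theta_perm x)); rewrite mulKVg.
by apply/permP=> z; rewrite permM !theta_permE thetaM.
Qed.

Definition theta_set : {set {perm S}} := [set theta_perm x | x in S].

Lemma mem_theta_set x : theta_perm x \in theta_set.
Proof. exact: imset_f. Qed.

(** Closure under [a^-1 * b] is [theta_permM]; the case [a = b] puts [1] in the
    set, the case [b = 1] gives inverses, and products follow. *)
Lemma theta_group_set : 0 < #|S| -> group_set theta_set.
Proof.
move=> /card_gt0P[x0 _].
have closed_div a b : a \in theta_set -> b \in theta_set ->
    a^-1 * b \in theta_set.
  by move=> /imsetP[x _ ->] /imsetP[y _ ->]; rewrite -theta_permM mem_theta_set.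
have A1 : 1 \in theta_set.
  by rewrite -(mulVg (theta_perm x0)) closed_div ?mem_theta_set.
apply/group_setP; split=> // a b Aa Ab.
by rewrite -[a]invgK closed_div // -[a^-1]mulg1 closed_div.
Qed.

(** By [theta_permM], [theta_y = theta_x] exactly when [theta_x y] lies in the
    fibre over [1]; so the permutation [theta_x] identifies the two fibres. *)
Lemma theta_perm_fibre a : a \in theta_set ->
  #|[set y | theta_perm y == a]| = #|[set y | theta_perm y == 1]|.
Proof.
case/imsetP=> x _ ->.
rewrite -[RHS](card_preimset _ (@perm_inj _ (theta_perm x))).
apply: eq_card => y; rewrite !inE theta_permM.
by rewrite eq_sym eq_mulVg1.
Qed.

Lemma card_theta_dvd : #|theta_set| %| #|S|.
Proof.
rewrite -[#|S|]sum1_card.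
rewrite (partition_big theta_perm [in theta_set]) /=; last first.
  by move=> x _; apply: mem_theta_set.
rewrite (eq_bigr (fun=> #|[set y | theta_perm y == 1]|)).
  by rewrite sum_nat_const dvdn_mulr.
move=> a Aa; rewrite -(theta_perm_fibre Aa) -sum1_card.
by apply: eq_bigl => y; rewrite inE.
Qed.

Lemma theta_trivial : 0 < #|S| -> #|theta_set| = 1%N ->
  forall x y, theta s x y = y.
Proof.
move=> S_gt0 A1 x y; rewrite -theta_permE.
have trivA : theta_set = 1.
  exact: (card1_trivg (G := group (theta_group_set S_gt0))).
by have := mem_theta_set x; rewrite trivA => /set1P ->; rewrite perm1.
Qed.

Lemma theta_perm_inj : #|theta_set| = #|S| -> injective theta_perm.
Proof. by move=> cardA; apply: in2T; apply/imset_injP/eqP. Qed.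

End ThetaGroup.

Section Classification.

Variables (p : nat) (p_prime : prime p).

Lemma card_Zp_prime : #|'Z_p| = p.
Proof. by rewrite card_ord Zp_cast ?prime_gt1. Qed.

Lemma Zp_isog (gT : finGroupType) (G : {group gT}) :
  #|G| = p -> G \isog [set: 'Z_p].
Proof.
move=> cardG.
have cardZ : #|[set: 'Z_p]| = p by rewrite cardsT card_Zp_prime.
by rewrite isog_cyclic_card ?prime_cyclic ?cardG ?cardZ /=.
Qed.

Lemma shift_solution_ok : comm_nondeg_left_zero_of_size p (@shift_solution p).
Proof.
have lz : left_zero_mul (pmul (@shift_solution p)) by [].
split; last exact: lz; first exact: card_Zp_prime.
- split; first exact: (inhabits 0%R).
  apply/(left_zero_pentagonP lz) => x y z; rewrite /theta /=.
  by rewrite opprD opprK addrACA subrr add0r.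
- exact: left_zero_commutative.
- move=> x; exists (+%R x) => y; rewrite /theta /=; last exact: addKr.
  exact: addNKr.
Qed.

Lemma trivial_solution_ok :
  comm_nondeg_left_zero_of_size p (@trivial_solution p).
Proof.
have lz : left_zero_mul (pmul (@trivial_solution p)) by [].
split; last exact: lz; first exact: card_Zp_prime.
- split; first exact: (inhabits 0%R).
  exact/(left_zero_pentagonP lz).
- exact: left_zero_commutative.
- by move=> x; exists id.
Qed.

(** An isomorphism would force every map [y |-> - x + y] to be the identity,
    which fails for [x = 1]. *)
Lemma shift_not_trivial :
  ~ isomorphic_solutions (@shift_solution p) (@trivial_solution p).
Proof.
case=> phi [/bij_inj phi_inj iso].
have /= [/phi_inj] := iso (1, 0)%R.
by rewrite addr0 => /eqP; rewrite oppr_eq0 oner_eq0.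
Qed.

Section PrimeSize.

Variables (S : finType) (s : S * S -> S * S).
Hypothesis cardS : #|S| = p.
Hypothesis s_left_zero : left_zero_mul (pmul s).

Lemma trivial_of_theta_id :
  (forall x y, theta s x y = y) -> isomorphic_solutions s (@trivial_solution p).
Proof.
move=> theta_id.
have eqSZ : #|S| = #|'Z_p| by rewrite cardS card_Zp_prime.
exists (enum_val \o cast_ord eqSZ \o enum_rank); split; last first.
  by move=> phi2 [x y]; rewrite /phi2 /trivial_solution /=
    left_zeroE //= theta_id.
apply: bij_comp; last exact: enum_rank_bij.
apply: bij_comp; first exact: enum_val_bij.
exact: Bijective (cast_ordK eqSZ) (cast_ordKV eqSZ).
Qed.

(** Here [theta_perm] is a bijection from [S] onto a group of order [p]; the
    isomorphism is its composite with an isomorphism of that group onto the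
    integers modulo [p], which turns [a^-1 * b] into [- x + y]. *)
Lemma shift_of_card_theta (s_nondeg : Defs.nondegenerate s)
    (thetaM : forall x y z, theta s (theta s x y) (theta s x z) = theta s y z) :
  #|theta_set s_nondeg| = p -> isomorphic_solutions s (@shift_solution p).
Proof.
move=> cardA.
have S_gt0 : 0 < #|S| by rewrite cardS prime_gt0.
pose A := group (theta_group_set s_nondeg thetaM S_gt0).
have /isogP[f /injmP f_inj _] : A \isog [set: 'Z_p] by apply: Zp_isog.
have AP x : theta_perm s_nondeg x \in A by apply: mem_theta_set.
exists (fun x => f (theta_perm s_nondeg x)); split.
  apply: inj_card_bij; last by rewrite cardS card_Zp_prime.
  move=> x y /(f_inj _ _ (AP x) (AP y)).
  by apply: theta_perm_inj; rewrite cardA.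
move=> phi2 [x y]; rewrite /phi2 /shift_solution /= left_zeroE //=.
congr (_, _).
rewrite -(theta_permE s_nondeg) theta_permM //.
have AVx : (theta_perm s_nondeg x)^-1 \in A by rewrite groupV.
by rewrite (morphM f AVx (AP y)) (morphV f (AP x)).
Qed.

End PrimeSize.

End Classification.

Theorem proposition27 (p : nat) (p_prime : prime p) :
  [/\ comm_nondeg_left_zero_of_size p (@shift_solution p),
      comm_nondeg_left_zero_of_size p (@trivial_solution p),
      ~ isomorphic_solutions (@shift_solution p) (@trivial_solution p)
    & forall (S : finType) (s : S * S -> S * S),
        comm_nondeg_left_zero_of_size p s ->
        isomorphic_solutions s (@shift_solution p) \/
        isomorphic_solutions s (@trivial_solution p)].
Proof.
split; first exact: shift_solution_ok.
- exact: trivial_solution_ok.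
- exact: shift_not_trivial.
move=> S s [cardS [_ pent] _ s_nondeg s_left_zero].
have thetaM := (left_zero_pentagonP s_left_zero).1 pent.
have := card_theta_dvd s_nondeg thetaM.
rewrite cardS => /(primeP p_prime).2 /orP[] /eqP cardA.
- right; apply: trivial_of_theta_id => //.
  by apply: (theta_trivial thetaM) cardA; rewrite cardS prime_gt0.
- by left; apply: shift_of_card_theta cardA.
Qed.
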